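(* Let $n=p_1\cdots p_k$ be the prime factorization of a square-free number $n$, let $G\cong\mathbb{Z}_{p_1}\times\cdots\times\mathbb{Z}_{p_k}$ be the cyclic group of order $n$, and let $\Delta$ be the generating set of $G$ corresponding to this direct product decomposition, consisting of one generator of each factor $\mathbb{Z}_{p_i}$. If $n$ is odd or $k\geq 3$, then the Cayley graph $(G,\Delta)$ is a Černý Cayley graph.
   Context: For a finite set $X$, $T_X$ is the set of all maps $X\to X$, acting on the right of $X$. An automaton with state set $X$ is a subset $\Sigma\subseteq T_X$, written $(X,\Sigma)$. The free monoid $\Sigma^*$ acts on the right of $X$ via the homomorphism $\Sigma^*\to T_X$ extending the inclusion $\Sigma\hookrightarrow T_X$. A word $w\in\Sigma^*$ is synchronizing if $|Xw|=1$; the automaton is synchronizing if it admits a synchronizing word. If $G$ is a finite group with generating set $\Delta$, elements of $\Delta$ are identified with the right translations $g\mapsto gd$ of $G$, so $\Delta\subseteq T_G$; the automaton $(G,\Delta)$ is the Cayley graph of $G$ with respect to $\Delta$. With $n=|G|$, $(G,\Delta)$ is a Černý Cayley graph if every synchronizing automaton $(G,\Sigma)$ with $\Delta\subseteq\Sigma\subseteq T_G$ admits a synchronizing word of length at most $(n-1)^2$. *)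

(* Defs.v *)
From mathcomp Require Import all_boot all_fingroup all_solvable.

Set Implicit Arguments.
Unset Strict Implicit.
Unset Printing Implicit Defensive.

Section Automata.

Variable X : finType.
Implicit Types (Sigma : {set {ffun X -> X}}) (w : seq {ffun X -> X}).

(* Maps act on the right, so the first letter of w is applied first. *)
Definition word_act (x : X) w : X := foldl (fun y (s : {ffun X -> X}) => s y) x w.

Definition synchronizing_word Sigma w : Prop :=
  {subset w <= Sigma} /\ #|[set word_act x w | x : X]| = 1.

Definition synchronizing Sigma : Prop := exists w, synchronizing_word Sigma w.

End Automata.

Section CayleyGraphs.

Variable gT : finGroupType.
Implicit Type Delta : {set gT}.

Definition right_translation (d : gT) : {ffun gT -> gT} := [ffun g => (g * d)%g].

Definition Cayley_automaton Delta : {set {ffun gT -> gT}} :=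
  [set right_translation d | d in Delta].

(* Cayley graphs are only considered with respect to generating sets, whence
   the first conjunct. *)
Definition Cerny_Cayley_graph Delta : Prop :=
  <<Delta>>%g = [set: gT] /\
  forall Sigma : {set {ffun gT -> gT}},
    Cayley_automaton Delta \subset Sigma -> synchronizing Sigma ->
    exists w, synchronizing_word Sigma w /\ size w <= (#|gT| - 1) ^ 2.

End CayleyGraphs.

(* Main.v *)
Require Import Defs.
From mathcomp Require Import all_boot all_fingroup all_solvable.
From mathcomp Require Import all_order all_algebra all_field.
From mathcomp Require Import ring zify.

(** A set S of states is enlarged by a word w when its preimage under w is
    larger than S.  Starting from the preimage of a point under a non-injective
    letter, which has at least two elements, n - 2 enlargements reach the whole
    group: the words used, concatenated in reverse order, then synchronize.  If
    every enlargement costs at most n letters, the resulting length is at most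
    1 + n (n - 2) = (n - 1)^2 (synchronizing_extension).

    Enlarging a proper nonempty S.  Let f be the indicator function of S, minus
    its mean, and let e be the dimension of the span of the translates of f.
    Pulling functions back along letters enlarges this span by at least one
    dimension per letter until some function in it has a nonzero sum, because a
    synchronizing word makes some sum nonzero; hence there are a word u of
    length at most n - e and an element g such that u followed by the
    translation by g changes the size of S (short_escape).  As the average of
    these sizes over all g is the size of S, some g enlarges S
    (preim_extension).  It remains to write the translation by g, as far as S
    can see it, with at most e letters of the generating set.  The generators
    that fix S may be dropped, so the sum of p_i - 1 over the generators d_i
    with S d_i <> S is enough (short_translation_word), and everything comes
    down to bounding e from below by this sum.

    The dimension e is the number of nontrivial characters at which the Fourier
    transform of S does not vanish (rank_translates).  Identify characters with
    elements of the cyclic group G, and let R be the set of those where the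
    transform is nonzero.
    - R is stable under the Galois group of the cyclotomic field, so it contains
      all elements of a given order as soon as it contains one (spectrum_order).
    - If S d_i <> S then p_i divides the order of some element of R
      (dvdn_order_spectrum).
    - If moreover p_i = 2, there is y such that y and y d_i are both in R
      (involution_spectrum).
    An element of odd order m brings all phi(m) of them into R, and phi(m) is at
    least the sum of q - 1 over the primes q dividing m.  Thus the set of the odd
    parts of the elements of R accounts for the odd primes (and for the trivial
    character), and the prime 2 is accounted for by y and y d_i, which have the
    same odd part (card_order_closed). *)

Set Implicit Arguments.
Unset Strict Implicit.
Unset Printing Implicit Defensive.

(** * Escaping from a hyperplane along words of linear maps *)

Section Escape.

Import GRing.Theory.
Local Open Scope ring_scope.

Variables (F : fieldType) (N : nat) (I : finType) (A : I -> 'M[F]_N).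
Implicit Types (U : 'M[F]_N) (w : seq I).

(** The letter applied first to a point is applied last to a function, so the
    first letter of the word is the rightmost factor. *)
Definition word_mx w : 'M[F]_N := foldr (fun s B => B *m A s) 1%:M w.

Lemma word_mx_rcons w s : word_mx (rcons w s) = A s *m word_mx w.
Proof.
by elim: w => /= [|t w ->]; rewrite ?mul1mx ?mulmx1 ?mulmxA.
Qed.

(** As long as the row space of U is killed by v, some letter must enlarge it,
    else it would be stable and no word could lead out of the kernel of v.  Each
    such letter costs one dimension, of which only N - rank U are available. *)
Lemma short_escape (Sigma : {set I}) U (v : 'cV[F]_N) w :
    {subset w <= Sigma} -> U *m word_mx w *m v != 0 ->
  exists w', [/\ {subset w' <= Sigma}, (size w' <= N - \rank U)%N
                & U *m word_mx w' *m v != 0].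
Proof.
move=> w_Sigma; have [k] := ubnP (N - \rank U); elim: k U => // k IHk U ltUk Uw.
have [Uv | nzUv] := eqVneq (U *m v) 0; last by exists [::]; rewrite /= mulmx1.
have [/forall_inP stabU | ] := boolP [forall s in Sigma, U *m A s <= U]%MS.
  (* a stable row space killed by v stays killed after any word *)
  suffices /submxP[C DC]: (U *m word_mx w <= U)%MS.
    by rewrite DC -mulmxA Uv mulmx0 eqxx in Uw.
  elim: w w_Sigma {IHk Uw} => [|s w IHw] sw_Sigma /=; first by rewrite mulmx1.
  rewrite mulmxA; apply: submx_trans (submxMr _ (IHw _)) (stabU s _) => [t wt|];
    by rewrite sw_Sigma ?inE ?wt ?eqxx ?orbT.
rewrite negb_forall_in => /exists_inP[s Ss nUs].
pose V := (U + U *m A s)%MS.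
have ltUV : (\rank U < \rank V)%N.
  by apply: rank_ltmx; rewrite /ltmx addsmxSl addsmx_sub submx_refl.
have leVN : (\rank V <= N)%N by apply: rank_leq_row.
have [||w' [w'_Sigma le_w' Vw']] := IHk V.
- by rewrite -ltnS (leq_trans _ ltUk) // ltnS ltn_sub2l // (leq_trans ltUV).
- have /submxP[C DU] := addsmxSl U (U *m A s).
  by apply: contraNneq Uw => Vw; rewrite {1}DU -!mulmxA (mulmxA V) Vw mulmx0.
have [Uw' | nzUw'] := eqVneq (U *m word_mx w' *m v) 0; last first.
  by exists w'; split=> //; rewrite (leq_trans le_w') // leq_sub2l // ltnW.
exists (rcons w' s); split.
- by move=> t; rewrite mem_rcons inE => /predU1P[->|/w'_Sigma].
- by rewrite size_rcons (leq_ltn_trans le_w') // ltn_sub2l // (leq_trans ltUV).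
apply: contraNneq Vw' => Usw'.
have /sub_addsmxP[[C1 C2] /= ->] := submx_refl V.
rewrite !mulmxDl -!mulmxA in Usw' Uw' *.
by rewrite word_mx_rcons -!mulmxA in Usw'; rewrite Uw' Usw' !mulmx0 addr0.
Qed.
End Escape.

(** * Preimages under words *)

Section Words.

Variable X : finType.
Implicit Types (Sigma : {set {ffun X -> X}}) (w : seq {ffun X -> X}) (S : {set X}).

Definition word_preim w S := [set x | word_act x w \in S].

Lemma word_act_cat x w1 w2 : word_act x (w1 ++ w2) = word_act (word_act x w1) w2.
Proof. exact: foldl_cat. Qed.

Lemma synchronizing_wordP Sigma w :
  synchronizing_word Sigma w <->
  {subset w <= Sigma} /\ exists x0, word_preim w [set x0] = [set: X].
Proof.
split=> [[w_Sigma /eqP/cards1P[x0 im_w]] | [w_Sigma [x0 /setP pre_w]]].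
  split=> //; exists x0; apply/setP=> x; rewrite !inE -in_set1 -im_w.
  exact: imset_f.
split=> //; suffices ->: [set word_act x w | x : X] = [set x0] by rewrite cards1.
have act_w x : word_act x w = x0 by apply/eqP; have := pre_w x; rewrite !inE.
apply/setP=> y; rewrite inE; apply/imsetP/eqP => [[x _ ->] | ->] //.
by exists x0.
Qed.

(** Hence a word that synchronizes at least two states has a letter that is not
    injective. *)
Lemma card_word_preim_injective w : {in w, forall s : {ffun X -> X}, injective s} ->
  forall x0, #|word_preim w [set x0]| <= 1.
Proof.
move=> w_inj x0; rewrite (leq_trans _ (eq_leq (cards1 x0))) //.
have act_inj : injective (fun x => word_act x w).
  elim: w w_inj => [|s w IHw] sw_inj x y /=; first by [].
  move=> eq_xy.
  have: s x = s y by apply: IHw eq_xy => t wt; apply: sw_inj; rewrite inE wt orbT.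
  by apply: sw_inj; rewrite inE eqxx.
rewrite -(card_imset _ act_inj) subset_leq_card //.
by apply/subsetP=> _ /imsetP[x + ->]; rewrite !inE.
Qed.

(** The matrix of f |-> f o s on functions encoded as row vectors. *)
Definition pullback_mx (F : fieldType) (s : {ffun X -> X}) : 'M[F]_#|X| :=
  (\matrix_(i, j) (i == enum_rank (s (enum_val j)))%:R)%R.

Lemma mul_word_mx (F : fieldType) (U : 'M[F]_#|X|) w i j :
  (U *m word_mx (pullback_mx F) w)%R i j = U i (enum_rank (word_act (enum_val j) w)).
Proof.
elim: w j => [|s w IHw] j /=; first by rewrite mulmx1 enum_valK.
rewrite mulmxA mxE (bigD1 (enum_rank (s (enum_val j)))) //= IHw enum_rankK.
rewrite mxE eqxx GRing.mulr1 big1 ?GRing.addr0 // => l /negPf nel.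
by rewrite [X in (_ * X)%R]mxE nel GRing.mulr0.
Qed.

End Words.

(** * Enlarging a set of group elements *)

Section Extension.

Import GRing.Theory Num.Theory.

Variable gT : finGroupType.
Implicit Types (S : {set gT}) (Sigma : {set {ffun gT -> gT}}).
Local Notation n := #|gT|.

(** Row g is the function x |-> 1_S(x g), normalized to have sum zero. *)
Definition translates_mx S : 'M[algC]_n :=
  (\matrix_(i, j) ((enum_val j * enum_val i)%g \in S)%:R
     - const_mx (#|S|%:R / n%:R))%R.

(** On average over g, the word w followed by the translation by g preserves
    the size of S: exchange the sums over g and over the points. *)
Lemma card_preim_translates w S :
  \sum_(g : gT) #|word_preim w [set x | (x * g)%g \in S]| = n * #|S|.
Proof.
under eq_bigr => g _ do rewrite -sum1_card big_mkcond.
rewrite exchange_big /= -sum_nat_const; apply: eq_bigr => x _.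
rewrite -big_mkcond sum1dep_card -(card_lcoset S (word_act x w)^-1)%g.
by apply: eq_card => g; rewrite mem_lcoset invgK !inE.
Qed.

Lemma translates_mx_deviation w S i :
  (translates_mx S *m word_mx (pullback_mx algC) w *m const_mx 1 : 'cV_n)%R i 0%R
  = (#|word_preim w [set x | (x * enum_val i)%g \in S]|%:R - #|S|%:R)%R.
Proof.
have n_gt0 : 0 < n by apply/card_gt0P; exists 1%g.
rewrite mxE.
under eq_bigr => j _ do rewrite mul_word_mx !mxE enum_rankK mulr1.
rewrite sumrB sumr_const card_ord -[X in (_ - X = _)%R]mulr_natr divfK ?pnatr_eq0 -?lt0n //.
congr (_ - _)%R.
rewrite (reindex enum_rank) /=; last by apply: onW_bij; apply: enum_rank_bij.
under eq_bigr => x _ do rewrite enum_rankK.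
rewrite -natr_sum -big_mkcond /= sum1dep_card; congr _%:R%R.
by apply: eq_card => x; rewrite !inE.
Qed.

(** A word u of length at most n - rank for which some translate of S changes
    size is followed by a word of length at most rank, which imitates the
    translation for which the size grows. *)
Lemma preim_extension Sigma S :
    synchronizing Sigma -> S != set0 -> S != [set: gT] ->
    (forall g, exists w, [/\ {subset w <= Sigma}, size w <= \rank (translates_mx S)
       & word_preim w S = [set x | (x * g)%g \in S]]) ->
  exists w, [/\ {subset w <= Sigma}, size w <= n & #|S| < #|word_preim w S|].
Proof.
move=> [w0 /synchronizing_wordP[w0_Sigma [x0 pre_w0]]] /set0Pn[s0 Ss0].
move=> S_proper S_short.
have ltSn : #|S| < n.
  by rewrite -[n]cardsT proper_card // properT.
have [|w [w_Sigma le_w nz_w]] := @short_escape algC n _ (@pullback_mx gT algC) Sigma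
    (translates_mx S) (const_mx 1%R) w0 w0_Sigma.
  (* translating s0 to the point reached by w0 makes the preimage everything *)
  apply/eqP=> /matrixP/(_ (enum_rank (x0^-1 * s0)%g) 0%R).
  rewrite translates_mx_deviation mxE enum_rankK => /eqP.
  rewrite subr_eq0 eqr_nat.
  have -> : word_preim w0 [set x | (x * (x0^-1 * s0))%g \in S] = setT.
    apply/setP=> x; have : x \in word_preim w0 [set x0] by rewrite pre_w0 inE.
    by rewrite !inE => /eqP->; rewrite mulKVg Ss0.
  by rewrite cardsT eq_sym ltn_eqF.
have [g ltS] : exists g, #|S| < #|word_preim w [set x | (x * g)%g \in S]|.
  (* if no size exceeded the average, all would be equal to it *)
  apply/existsP; apply: contraNT nz_w; rewrite negb_exists => /forallP le_pre.
  have le_pre' g : true -> #|word_preim w [set x | (x * g)%g \in S]| <= #|S| ?= iff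
      (#|word_preim w [set x | (x * g)%g \in S]| == #|S|).
    by move=> _; apply/leqif_eq; rewrite leqNgt.
  have [_ ] := leqif_sum le_pre'.
  rewrite card_preim_translates sum_nat_const eqxx => /esym/forall_inP eq_pre.
  apply/eqP/matrixP=> i j; rewrite ord1 translates_mx_deviation mxE.
  by rewrite (eqP (eq_pre _ _)) // subrr.
have [w' [w'_Sigma le_w' pre_w']] := S_short g.
exists (w ++ w'); split.
- by move=> s; rewrite mem_cat => /orP[/w_Sigma|/w'_Sigma].
- rewrite size_cat -(subnK (rank_leq_row (translates_mx S))).
  exact: leq_add.
- congr (_ < _): ltS; apply: eq_card => x; rewrite [in RHS]inE word_act_cat.
  by rewrite -pre_w' !inE.
Qed.

(** One letter gives a preimage of size 2, and n - 2 enlargements at a cost of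
    n letters each give the whole group: 1 + n (n - 2) = (n - 1)^2. *)
Lemma synchronizing_extension Sigma :
    synchronizing Sigma ->
    (forall S, S != set0 -> S != [set: gT] ->
       exists w, [/\ {subset w <= Sigma}, size w <= n & #|S| < #|word_preim w S|]) ->
  exists w, synchronizing_word Sigma w /\ size w <= (n - 1) ^ 2.
Proof.
move=> sync_Sigma ext_Sigma.
have [n_le1 | n_gt1] := leqP n 1.
  exists [::]; split; last by [].
  apply/synchronizing_wordP; split=> //; exists 1%g; apply/setP=> x.
  rewrite !inE /=; apply/eqP; move: n_le1 => /card_le1P/(_ 1%g isT x).
  by rewrite !inE => /esym/eqP.
have [w0 /synchronizing_wordP[w0_Sigma [x0 pre_w0]]] := sync_Sigma.
have [s Ss s_ninj] : exists2 s, s \in Sigma & ~~ injectiveb s.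
  apply/exists_inP; apply: contraLR n_gt1; rewrite negb_exists_in -leqNgt.
  move/forall_inP=> inj_Sigma; rewrite -cardsT -pre_w0.
  apply: card_word_preim_injective => t /w0_Sigma/inj_Sigma.
  by rewrite negbK => /injectiveP.
have [x [y ne_xy eq_s]] : exists x, exists2 y, x != y & s x = s y.
  by case/injectivePn: s_ninj => x [y ne_xy eq_s]; exists x, y; rewrite // eq_sym.
have grow k : k <= n - 2 -> exists w, [/\ {subset w <= Sigma}, size w <= 1 + n * k
                & k + 2 <= #|word_preim w [set s x]|].
  elim: k => [_ | k IHk ltk].
    exists [:: s]; split=> // [t|]; first by rewrite inE => /eqP->.
    rewrite add0n -[2]/(true.+1) -ne_xy -cards2 subset_leq_card //.
    by apply/subsetP=> z; rewrite !inE /= => /orP[]/eqP->; rewrite ?eq_s.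
  have [w [w_Sigma le_w le_k]] := IHk (ltnW ltk).
  set T := word_preim w _ in le_k.
  have [T_full | T_proper] := eqVneq T [set: gT].
    exists w; split=> //; first
      by rewrite (leq_trans le_w) // leq_add2l leq_mul2l leqnSn orbT.
    by rewrite -/T T_full cardsT -(subnK n_gt1) leq_add2r.
  have T_n0 : T != set0 by rewrite -card_gt0 (leq_trans _ le_k) // addn2.
  have [w' [w'_Sigma le_w' ltT]] := ext_Sigma T T_n0 T_proper.
  exists (w' ++ w); split.
  - by move=> t; rewrite mem_cat => /orP[/w'_Sigma|/w_Sigma].
  - by rewrite size_cat mulnS addnCA leq_add.
  - rewrite (leq_trans _ (eq_leq (eq_card (A := word_preim w' T) _))) //.
      by rewrite addSn (leq_ltn_trans le_k).
    by move=> z; rewrite !inE word_act_cat.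
have [w [w_Sigma le_w full_w]] := grow _ (leqnn _).
rewrite subnK // in full_w.
exists w; split.
  apply/synchronizing_wordP; split=> //; exists (s x); apply/eqP.
  by rewrite eqEcard subsetT cardsT.
apply: leq_trans le_w _; case: n n_gt1 => [|[|m]] // _.
by rewrite subn1 subn2 /= -mulnn; nia.
Qed.

End Extension.

(** * Fourier analysis on a cyclic group *)

Lemma odd_card_involution (T : finType) (A : {set T}) (f : T -> T) (x : T) :
    {in A, forall y, f y \in A} -> {in A, involutive f} ->
    x \in A -> {in A, forall y, f y = y <-> y = x} ->
  odd #|A|.
Proof.
move=> fA fK Ax fix_x.
(* one representative of each two-element orbit *)
pose B := [set y in A | enum_rank y < enum_rank (f y)].
have f_inj : {in B &, injective f}.
  move=> y z; rewrite !inE => /andP[Ay _] /andP[Az _] eq_f.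
  by rewrite -(fK y) // eq_f fK.
have DA : A = x |: (B :|: f @: B).
  apply/setP=> y; rewrite in_setU1 in_setU; apply/idP/idP=> [Ay | ].
    have [// | ne_yx /=] := eqVneq y x; rewrite !inE Ay /=.
    case: ltngtP => // [lt_fy | /val_inj/enum_rank_inj/esym/(fix_x _ Ay)/eqP].
      by apply/imsetP; exists (f y); rewrite ?inE ?fA ?fK.
    by rewrite (negPf ne_yx).
  case/predU1P=> [-> // | /orP[]]; first by rewrite inE => /andP[].
  by case/imsetP=> z + ->; rewrite inE => /andP[/fA].
have disjB : B :&: f @: B = set0.
  apply/setP=> y; rewrite !inE; apply/negP=> /andP[/andP[Ay lt_y]].
  case/imsetP=> z; rewrite inE => /andP[Az lt_z] Dy.
  by rewrite Dy fK // ltnNge ltnW in lt_y.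
have nx : x \notin B :|: f @: B.
  have fx : f x = x by apply/fix_x.
  rewrite !inE Ax fx ltnn /=; apply/imsetP=> -[z].
  rewrite inE => /andP[Az lt_z] Dx; have Dz : z = x by rewrite -fx Dx fK.
  by rewrite Dz fx ltnn in lt_z.
by rewrite DA cardsU1 nx cardsU disjB cards0 subn0 card_in_imset //= addnn odd_double.
Qed.

Section Fourier.

Import GRing.Theory Num.Theory.
Local Open Scope ring_scope.

Variables (gT : finGroupType) (c : gT) (zeta : algC).
Hypotheses (c_gen : <[c]>%g = [set: gT]) (zeta_prim : #|gT|.-primitive_root zeta).
Local Notation n := #|gT|.
Implicit Types (x y h t : gT) (S : {set gT}).

(** The default value is never taken, as c is a generator (dlogK). *)
Definition dlog x : nat :=
  if [pick i : 'I_#[c]%g | (c ^+ i)%g == x] is Some i then i else 0%N.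

Lemma dlogK x : (c ^+ dlog x)%g = x.
Proof.
rewrite /dlog; case: pickP => [i /eqP // | no_i].
have /cyclePmin[i lt_i Dx] : x \in <[c]>%g by rewrite c_gen inE.
by have := no_i (Ordinal lt_i); rewrite /= -Dx eqxx.
Qed.

Lemma order_gen : #[c]%g = n.
Proof. by rewrite orderE c_gen cardsT. Qed.

Lemma mulg_commute x y : commute x y.
Proof. by rewrite -(dlogK x) -(dlogK y); apply: commuteX2. Qed.

(** The symmetric pairing given by the isomorphism of G with its dual that sends
    c to the character mapping c to zeta: the character indexed by y has the
    same order as y. *)
Definition chi y x : algC := zeta ^+ (dlog y * dlog x).

Lemma chiC y x : chi y x = chi x y.
Proof. by rewrite /chi mulnC. Qed.

Lemma chiM y x x' : chi y (x * x')%g = chi y x * chi y x'.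
Proof.
rewrite /chi -exprD -mulnDr !(mulnC (dlog y)) !exprM; congr (_ ^+ _).
apply/eqP; rewrite (eq_prim_root_expr zeta_prim) -order_gen -eq_expg_mod_order.
by rewrite expgD !dlogK.
Qed.

Lemma chiMl y y' x : chi (y * y')%g x = chi y x * chi y' x.
Proof. by rewrite !(chiC _ x) chiM. Qed.

Lemma chi_neq0 y x : chi y x != 0.
Proof.
rewrite /chi expf_neq0 //; apply/eqP=> zeta0; have := prim_expr_order zeta_prim.
rewrite zeta0 expr0n gtn_eqF ?(prim_order_gt0 zeta_prim) // => /esym/eqP.
by rewrite oner_eq0.
Qed.

Lemma chi1 y : chi y 1%g = 1.
Proof. by apply: (mulfI (chi_neq0 y 1%g)); rewrite -chiM mulg1 mulr1. Qed.

Lemma chi1l x : chi 1%g x = 1.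
Proof. by rewrite chiC chi1. Qed.

Lemma chiX y x k : chi y (x ^+ k)%g = chi y x ^+ k.
Proof. by elim: k => [|k IHk]; rewrite ?chi1 // expgS chiM IHk exprS. Qed.

Lemma chiXl y x k : chi (y ^+ k)%g x = chi y x ^+ k.
Proof. by rewrite !(chiC _ x) chiX. Qed.

Lemma chiV y x : chi y^-1%g x = chi y x^-1%g.
Proof.
by apply: (mulfI (chi_neq0 y x)); rewrite -chiM -chiMl !mulgV chi1 chi1l.
Qed.

Lemma sum_chi y : \sum_x chi y x = (n * (y == 1%g))%:R.
Proof.
have [-> | ny] := eqVneq y 1%g.
  under eq_bigr => x _ do rewrite chi1l.
  by rewrite sumr_const muln1 (eq_card (B := gT)).
have chi_c : chi y c != 1.
  rewrite /chi -(prim_order_dvd zeta_prim) -order_gen order_dvdn.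
  by rewrite mulnC expgM dlogK dlogK.
rewrite muln0; apply: (mulfI (x := chi y c - 1)); rewrite ?subr_eq0 // mulr0.
rewrite mulrBl mul1r [X in _ - X](reindex_inj (mulgI c)) /= mulr_sumr -sumrB.
by rewrite big1 // => x _; rewrite chiM subrr.
Qed.

Definition transform (a : gT -> algC) y := \sum_x a x * chi y x.

(** Fourier inversion, in the form of injectivity. *)
Lemma transform_inj a : (forall y, transform a y = 0) -> forall x, a x = 0.
Proof.
move=> a0 x; have n_neq0 : n%:R != 0 :> algC.
  by rewrite pnatr_eq0 -lt0n (prim_order_gt0 zeta_prim).
apply: (mulIf n_neq0); rewrite mul0r.
have <- : \sum_y chi y x^-1%g * transform a y = 0.
  by rewrite big1 // => y _; rewrite a0 mulr0.
symmetry; under eq_bigr => y _ do rewrite mulr_sumr.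
rewrite exchange_big /= (bigD1 x) //= [X in _ + X]big1 ?addr0 => [|h ne_hx].
  under eq_bigr => y _ do rewrite mulrCA -chiM mulVg chi1 mulr1.
  by rewrite sumr_const mulr_natr (eq_card (B := gT)).
under eq_bigr => y _ do rewrite mulrCA -chiM chiC.
rewrite -mulr_sumr sum_chi -(inj_eq (mulgI x)) mulKVg mulg1 (negPf ne_hx).
by rewrite muln0 mulr0.
Qed.

Definition set_transform S y := \sum_(x in S) chi y x.

Lemma set_transformE S y : set_transform S y = transform (fun x => (x \in S)%:R) y.
Proof.
rewrite /set_transform big_mkcond; apply: eq_bigr => x _.
by case: (x \in S); rewrite ?mul1r ?mul0r.
Qed.

Definition spectrum S := [set y | set_transform S y != 0].

Lemma spectrum1 S : S != set0 -> 1%g \in spectrum S.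
Proof.
move=> nS; rewrite inE /set_transform; under eq_bigr do rewrite chi1l.
by rewrite sumr_const pnatr_eq0 cards_eq0.
Qed.

(** Elements of the same order are powers of each other, with exponents that are
    realized by automorphisms of the algebraic numbers acting on the roots of
    unity. *)
Lemma spectrum_order S x y : #[x]%g = #[y]%g -> y \in spectrum S -> x \in spectrum S.
Proof.
move=> eq_xy; rewrite !inE; apply: contraNneq => Sx.
have eq_cyc : <[y]>%g = <[x]>%g.
  apply/eqP; rewrite (eq_subG_cyclic (G := [set: gT]%G)) ?subsetT //.
    by rewrite -!orderE eq_xy.
  by apply/cyclicP; exists c.
have /cyclePmin[k _ Dy] : y \in <[x]>%g by rewrite -eq_cyc cycle_id.
have co_k : coprime k #[x]%g.
  by rewrite coprime_sym -generator_coprime -Dy /generator eq_cyc.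
have [u Du] := Qn_aut_exists co_k.
rewrite -[0](rmorph0 u) -Sx rmorph_sum; apply/eqP/eq_bigr => h _.
by rewrite Dy chiXl Du // -chiXl expg_order chi1l.
Qed.

(** Each nontrivial character of the spectrum is, up to a nonzero factor, a
    combination of translates of S; by orthogonality the product of the matrix
    of translates with suitable character matrices is the identity. *)
Lemma rank_translates S : (#|spectrum S :\ 1%g| <= \rank (translates_mx S))%N.
Proof.
set R1 := spectrum S :\ 1%g.
have n_neq0 : n%:R != 0 :> algC.
  by rewrite pnatr_eq0 -lt0n (prim_order_gt0 zeta_prim).
pose L : 'M[algC]_(#|R1|, n) := \matrix_(i, j) chi (enum_val i) (enum_val j).
pose B : 'M[algC]_(n, #|R1|) :=
  \matrix_(j, l) (chi (enum_val l) (enum_val j) / (n%:R * set_transform S (enum_val l))).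
have LM i j : (L *m translates_mx S) i j =
    set_transform S (enum_val i) * chi (enum_val i) (enum_val j)^-1%g.
  rewrite mxE (reindex enum_rank) /=; last by apply: onW_bij; apply: enum_rank_bij.
  under eq_bigr => g _ do rewrite !mxE enum_rankK mulrBr.
  rewrite sumrB -mulr_suml sum_chi.
  have /setD1P[/negPf-> _] := enum_valP i; rewrite muln0 mul0r subr0.
  rewrite (reindex_inj (mulgI (enum_val j)^-1%g)) /= set_transformE mulr_suml.
  by apply: eq_bigr => h _; rewrite mulKVg chiM; ring.
have LMB : L *m translates_mx S *m B = 1%:M.
  apply/matrixP=> i l; rewrite mxE (reindex enum_rank) /=; last first.
    by apply: onW_bij; apply: enum_rank_bij.
  pose yi := enum_val i; pose yl := enum_val l.
  have E x : (L *m translates_mx S) i (enum_rank x) * B (enum_rank x) l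
      = set_transform S yi / (n%:R * set_transform S yl) * chi (yi^-1 * yl)%g x.
    by rewrite LM !mxE enum_rankK chiMl chiV; ring.
  rewrite (eq_bigr _ (fun x _ => E x)) -mulr_sumr sum_chi -eq_mulVg1 mxE.
  rewrite (inj_eq enum_val_inj); case: eqVneq => [eq_il | _]; last by rewrite muln0 mulr0.
  have : yl \in R1 := enum_valP l.
  rewrite /yi eq_il -/yl !inE muln1 => /andP[_ nz_l].
  by rewrite [n%:R * _]mulrC invfM mulrA divff // mul1r mulVf.
by rewrite -(mxrank1 algC #|R1|) -LMB (leq_trans (mxrankM_maxl _ _)) // mxrankM_maxr.
Qed.

Lemma set_transform_rcoset S t y :
  set_transform (S :* t)%g y = chi y t * set_transform S y.
Proof.
rewrite /set_transform -rcosetE /rcoset (big_imset _ (in2W (mulIg t))) /= mulr_sumr.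
by apply: eq_bigr => x _; rewrite chiM mulrC.
Qed.

Lemma set_transform_inj S T :
  (forall y, set_transform S y = set_transform T y) -> S = T.
Proof.
move=> eqST; apply/setP=> x.
have /eqP : (x \in S)%:R - (x \in T)%:R = 0 :> algC.
  move: x; apply: transform_inj => y.
  have := eqST y; rewrite !set_transformE => /eqP; rewrite -subr_eq0 => /eqP<-.
  by rewrite -sumrB; apply: eq_bigr => x _; rewrite mulrBl.
by rewrite subr_eq0 eqr_nat; do 2!case: (_ \in _).
Qed.

(** Translating S by t multiplies its transform at y by chi y t, which is 1 when
    the order of y is prime to that of t; if this were the case on the whole
    spectrum, S and its translate would have the same transform. *)
Lemma dvdn_order_spectrum S t :
  prime #[t]%g -> (S :* t != S)%g -> exists2 y, y \in spectrum S & (#[t]%g %| #[y]%g)%N.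
Proof.
move=> t_prime nSt; apply/exists_inP; apply: contraNT nSt.
rewrite negb_exists_in => /forall_inP no_y; apply/eqP/set_transform_inj => y.
rewrite set_transform_rcoset.
have [-> | nz_y] := eqVneq (set_transform S y) 0; first by rewrite mulr0.
suffices -> : chi y t = 1 by rewrite mul1r.
have co_ty : coprime #[t]%g #[y]%g by rewrite prime_coprime // no_y // inE.
have /cycleP[k ->] : t \in <[t ^+ #[y]%g]>%g.
  have /eqP <- : generator <[t]>%g (t ^+ #[y]%g)%g by rewrite generator_coprime.
  exact: cycle_id.
by rewrite chiX chiX -chiXl expg_order chi1l expr1n.
Qed.

(** Otherwise the product of the transforms at y and at y t vanishes for all y.
    It is the transform of the function N sending a to the sum of the signs
    chi t k over the k in S with a / k in S, so N = 0 and the number of these k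
    is even for every a.  Now take a = x^2: the involution k |-> a / k has as
    fixed points exactly those of x and x t that belong to S.  Hence x and x t
    are in S together, and S is stable under t. *)
Lemma involution_spectrum S t : #[t]%g = 2%N -> (S :* t != S)%g ->
  exists y, y \in spectrum S /\ (y * t)%g \in spectrum S.
Proof.
move=> t2 nSt.
pose A a := [set k in S | (a * k^-1)%g \in S].
pose N a := \sum_(k in A a) chi t k.
have [/exists_inP[y Sy Syt] | no_y] :=
    boolP [exists y in spectrum S, (y * t)%g \in spectrum S].
  by exists y.
have N0 a : N a = 0.
  move: a; apply: transform_inj => y.
  have : set_transform S y * set_transform S (y * t)%g = 0.
    apply/eqP; apply: contraNT no_y; rewrite mulf_eq0 negb_or => /andP[Sy Syt].
    by apply/exists_inP; exists y; rewrite inE.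
  move=> <-; rewrite /transform.
  under eq_bigr => x _ do rewrite mulr_suml big_mkcond /=.
  rewrite exchange_big /= mulrC mulr_suml [RHS]big_mkcond; apply: eq_bigr => k _ /=.
  have [Sk | nSk] := boolP (k \in S); last first.
    by rewrite big1 // => x _; rewrite inE (negPf nSk).
  rewrite mulr_sumr (reindex_inj (mulIg k)) [RHS]big_mkcond; apply: eq_bigr => h _ /=.
  by rewrite inE Sk mulgK /=; case: ifP => // _; rewrite chiM chiMl; ring.
(* chi t takes the values 1 and -1 *)
have chit k : chi t k = (2 * (chi t k == 1))%:R - 1.
  have : chi t k ^+ 2 = 1 by rewrite -chiXl -t2 expg_order chi1l.
  move/eqP; rewrite -subr_eq0 subr_sqr_1 mulf_eq0 subr_eq0.
  case: eqVneq => [-> _ | _ /=]; first by rewrite muln1; ring.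
  by rewrite addr_eq0 muln0 sub0r => /eqP.
suffices St : {in S, forall x, (x * t)%g \in S}.
  case/eqP: nSt; apply/eqP; rewrite eqEcard card_rcoset leqnn andbT.
  by apply/subsetP=> _ /rcosetP[x Sx ->]; apply: St.
move=> x Sx; apply/idPn=> nSxt.
(* as N vanishes, the two signs occur equally often *)
have ev : #|A (x * x)%g| = (2 * #|[set k in A (x * x)%g | chi t k == 1%R]|)%N.
  have := N0 (x * x)%g; rewrite /N; under eq_bigr => k _ do rewrite chit.
  rewrite sumrB sumr_const -natr_sum -big_distrr /= -sum1_card => /eqP.
  rewrite subr_eq0 eqr_nat eq_sym => /eqP->; congr (2 * _)%N.
  by rewrite -sum1dep_card big_mkcondr /=; apply: eq_bigr => k _; case: eqP.
have : odd #|A (x * x)%g|; last by rewrite ev oddM.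
have invol k : (x * x * (x * x * k^-1)^-1 = k)%g.
  by rewrite (mulg_commute _ k^-1%g) invMg invgK mulKVg.
apply: (@odd_card_involution _ _ (fun k => (x * x * k^-1)%g) x).
- by move=> k; rewrite !inE invol andbC.
- by move=> k _ /=; rewrite invol.
- by rewrite !inE mulgK Sx.
move=> k; rewrite inE => /andP[Sk _]; split=> [Dk | ->]; last by rewrite mulgK.
apply/eqP; rewrite eq_mulgV1; apply: contraNT nSxt => ne_kx.
have kk : (k ^+ 2 = x ^+ 2)%g by rewrite !expgS !expg0 !mulg1 -{1}Dk mulgKV.
have o_kx : #[(k * x^-1)%g]%g = #[t]%g.
  rewrite t2; apply: nt_prime_order => //.
  by rewrite expgMn; [rewrite kk expgVn mulgV | apply: mulg_commute].
have eq_cyc : <[k * x^-1]>%g = <[t]>%g.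
  apply/eqP; rewrite (eq_subG_cyclic (G := [set: gT]%G)) ?subsetT -?orderE ?o_kx //.
  by apply/cyclicP; exists c.
have : (k * x^-1)%g \in <[t]>%g by rewrite -eq_cyc cycle_id.
case/cyclePmin=> [[|[|m]]]; rewrite ?t2 // => _ Dt.
  by rewrite Dt eqxx in ne_kx.
by rewrite -[t]expg1 -Dt mulg_commute mulgKV.
Qed.

End Fourier.

(** * Counting elements by their orders *)

Section Counting.

Lemma leq_sum_prod (s : seq nat) : all (leq 2) s -> \sum_(a <- s) a <= \prod_(a <- s) a.
Proof.
move=> s_ge2; suffices [[-> ->] // | []//] :
    \sum_(a <- s) a = 0 /\ \prod_(a <- s) a = 1
    \/ \sum_(a <- s) a <= \prod_(a <- s) a /\ 2 <= \prod_(a <- s) a.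
elim: s s_ge2 => [_ | a s IHs /= /andP[a_ge2 /IHs]]; first by rewrite !big_nil; left.
by rewrite !big_cons; case=> [[-> ->] | [le_s ge2_s]]; right; nia.
Qed.

(** The totient is at least the product of the q - 1, and these factors are at
    least 2 because o is odd. *)
Lemma leq_sum_primes_totient o : odd o -> \sum_(q <- primes o) q.-1 <= totient o.
Proof.
move=> odd_o; have o_gt0 : 0 < o by case: o odd_o.
rewrite totientE // -(big_map predn xpredT id).
apply: (@leq_trans (\prod_(q <- primes o) q.-1)).
  rewrite -(big_map predn xpredT id); apply: leq_sum_prod.
  apply/allP=> _ /mapP[q + ->]; rewrite mem_primes => /and3P[q_pr _ q_o].
  by have := odd_prime_gt2 (dvdn_odd q_o odd_o) q_pr; case: q {q_pr q_o}.
rewrite big_seq_cond [leqRHS]big_seq_cond; apply: leq_prod => q.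
rewrite andbT mem_primes => /andP[q_pr _]; rewrite leq_pmulr // expn_gt0.
by rewrite prime_gt0.
Qed.

Variables (gT : finGroupType) (I : finType) (p : I -> nat).
Hypotheses (p_prime : forall i, prime (p i)) (p_inj : injective p).
Implicit Types (A : {set I}) (R : {set gT}).

(** Each order o occurring in R contributes phi(o) elements, enough for all the
    primes dividing o; the trivial element is the extra 1. *)
Lemma card_odd_order_closed A R :
    (forall x y, #[x]%g = #[y]%g -> y \in R -> x \in R) -> 1%g \in R ->
    {in R, forall y, odd #[y]%g} ->
    {in A, forall i, exists2 y, y \in R & p i %| #[y]%g} ->
  1 + \sum_(i in A) (p i).-1 <= #|R|.
Proof.
move=> R_closed R1 R_odd A_R.
rewrite (cardsD1 1%g) R1 leq_add2l; set R' := R :\ 1%g.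
pose h (y : gT) : 'I_#|gT|.+1 := inord #[y]%g.
have hE y : h y = #[y]%g :> nat.
  by rewrite inordK // ltnS -[leqRHS]cardsT subset_leq_card ?subsetT.
pose P (o : 'I_#|gT|.+1) := [exists y in R', h y == o].
rewrite -sum1_card (partition_big h P) => [|y Ry]; last by apply/exists_inP; exists y.
apply: (@leq_trans (\sum_(i in A) \sum_(o | P o && (p i %| o)) (p i).-1)).
  apply: leq_sum => i /A_R[y Ry dv_y].
  have Py : P (h y) && (p i %| h y).
    rewrite hE dv_y andbT; apply/exists_inP; exists y => //; rewrite !inE Ry andbT.
    by apply: contraTneq dv_y => ->; rewrite order1 dvdn1 gtn_eqF ?prime_gt1.
  by rewrite (bigD1 (h y)) //= leq_addr.
rewrite (exchange_big_dep P) /= => [|i o _ /andP[] //].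
apply: leq_sum => o /exists_inP[y /setD1P[ny Ry] /eqP ho].
have {ho} Do : o = #[y]%g :> nat by rewrite -ho hE.
apply: (@leq_trans (totient o)).
  apply: leq_trans (leq_sum_primes_totient _); last by rewrite Do R_odd.
  rewrite -big_enum_cond /= -(big_map p (fun q => (_ && (q %| o))) predn) -big_filter.
  apply: uniq_sub_le_big => [//|a b|||]; rewrite ?leq_addr ?primes_uniq //.
    by rewrite filter_uniq // map_inj_uniq // enum_uniq.
  move=> q; rewrite mem_filter => /andP[/andP[_ q_o] /mapP[i _ Dq]].
  by rewrite mem_primes q_o Do order_gt0 Dq p_prime.
rewrite Do totient_gen sum1dep_card subset_leq_card //; apply/subsetP=> z.
rewrite !inE /generator => /eqP eq_yz.
have o_z : #[z]%g = #[y]%g by rewrite !orderE eq_yz.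
rewrite (R_closed z y) // -order_eq1 o_z order_eq1 ny /=.
by apply/eqP/val_inj; rewrite /= hE o_z.
Qed.

(** The set of odd parts satisfies the hypotheses of the odd case.  If the prime
    2 occurs, y and y * t have the same odd part, so that there are fewer odd
    parts than elements of R, which pays for 2 - 1. *)
Lemma card_order_closed A R :
    (forall x y : gT, commute x y) ->
    (forall x y, #[x]%g = #[y]%g -> y \in R -> x \in R) -> 1%g \in R ->
    {in A, forall i, exists2 y, y \in R & p i %| #[y]%g} ->
    {in A, forall i, p i = 2 ->
       exists t y, [/\ #[t]%g = 2, y \in R & (y * t)%g \in R]} ->
  1 + \sum_(i in A) (p i).-1 <= #|R|.
Proof.
move=> gT_comm R_closed R1 A_R A_2.
pose f (y : gT) := (y.`_2^')%g; pose R' := f @: R.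
pose A' := A :\: [set i | p i == 2].
have bound' : 1 + \sum_(i in A') (p i).-1 <= #|R'|.
  apply: card_odd_order_closed.
  - move=> x _ /[swap] /imsetP[y Ry ->]; rewrite /f order_constt => o_x.
    have x_2' : (2^').-elt%g x by rewrite /p_elt o_x part_pnat.
    apply/imsetP; exists (x * y.`_2)%g.
      apply: R_closed Ry; rewrite orderM //.
        by rewrite o_x order_constt mulnC partnC.
      by rewrite o_x order_constt coprime_sym coprime_partC.
    have -> : f (x * y.`_2)%g = x; last by [].
    rewrite /f consttM // (constt_p_elt x_2') (constt1P _) ?mulg1 //.
    by rewrite p_eltNK p_elt_constt.
  - by apply/imsetP; exists 1%g; rewrite /f ?constt1.
  - by move=> _ /imsetP[y _ ->]; rewrite odd_2'nat; apply: p_elt_constt.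
  move=> i /setDP[Ai]; rewrite inE => p_i_n2; have [y Ry dv_y] := A_R i Ai.
  exists (f y); first exact: imset_f.
  move: dv_y; rewrite /f order_constt -[X in _ %| X -> _](partnC 2) //.
  rewrite Gauss_dvdr // prime_coprime // p_part.
  by rewrite Euclid_dvdX // dvdn_prime2 // (negPf p_i_n2).
have [/exists_inP[i Ai /eqP p_i2] | no_2] := boolP [exists i in A, p i == 2]; last first.
  apply: leq_trans (leq_imset_card f R); suffices -> : A = A' by [].
  apply/setP=> i; rewrite !inE andbC; have [Ai /= | //] := boolP (i \in A).
  by apply/esym; apply: contraNN no_2 => p_i2; apply/exists_inP; exists i.
have DA : A = i |: A'.
  apply/setP=> j; rewrite !inE -p_i2 (inj_eq p_inj) orb_andr orbN.
  by have [-> | //] := eqVneq j i.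
rewrite DA big_setU1 ?inE ?p_i2 ?eqxx //= add1n.
apply: leq_ltn_trans bound' _; rewrite ltn_neqAle leq_imset_card andbT.
have [t [y [t2 Ry Ryt]]] := A_2 i Ai p_i2.
apply/imset_injP=> f_inj.
have : y = (y * t)%g.
  apply: f_inj => //; rewrite /f consttM //.
  have -> : (t.`_2^')%g = 1%g by apply/constt1P; rewrite p_eltNK /p_elt t2.
  by rewrite mulg1.
move/eqP; rewrite -[X in X == _]mulg1 (inj_eq (mulgI y)) eq_sym => /eqP t1.
by rewrite t1 order1 in t2.
Qed.

End Counting.

(** * Products of cyclic groups of distinct prime orders *)

Section SquareFree.

Variables (gT : finGroupType) (k : nat) (p : 'I_k -> nat) (H : 'I_k -> {group gT}).
Hypotheses (p_prime : forall i, prime (p i)) (p_inj : injective p)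
  (H_order : forall i, #|H i| = p i).

Lemma cyclic_bigdprod_distinct_primes (s : seq 'I_k) (G : {group gT}) :
  uniq s -> \big[dprod/1%g]_(i <- s) (H i : {set gT}) = G -> cyclic G.
Proof.
elim: s G => [|i s IHs] G /=; first by rewrite big_nil => _ <-; apply: cyclic1.
case/andP=> s'i s_uniq; rewrite big_cons => /[dup] defG.
case/dprodP=> [[_ L _ defL] <- cHL _]; rewrite defL in defG cHL *.
apply: cyclicM => //; [ | exact: IHs defL | ].
  by rewrite prime_cyclic // H_order.
rewrite -(bigdprod_card defL) coprime_sym big_seq.
elim/big_rec: _ => [|j m s_j co_m]; first by rewrite coprime1n.
rewrite coprimeMl co_m andbT !H_order prime_coprime // dvdn_prime2 // (inj_eq p_inj).
by apply: contraNneq s'i => <-.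
Qed.

End SquareFree.

Section ShortWords.

Variables (gT : finGroupType) (I : finType) (d : I -> gT).
Hypothesis gT_comm : forall x y : gT, commute x y.
Implicit Types (S : {set gT}).

Lemma mem_rcoset_fix S t x m : (S :* t = S)%g -> ((x * t ^+ m)%g \in S) = (x \in S).
Proof.
move=> St; elim: m x => [|m IHm] x; first by rewrite mulg1.
by rewrite expgS mulgA IHm -{1}St mem_rcoset mulgK.
Qed.

(** The factors that fix S need not be spelled out: they can be moved to the
    right of the product, where S does not see them. *)
Lemma short_translation_word S (a : I -> nat) (s : seq I) :
  exists w, [/\ {subset w <= Cayley_automaton [set d i | i : I]},
    size w = \sum_(i <- s | (S :* d i != S)%g) a i
    & word_preim w S = [set x | (x * \prod_(i <- s) d i ^+ a i)%g \in S]].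
Proof.
elim: s => [|i s [w [w_Cay size_w pre_w]]].
  exists [::]; rewrite !big_nil; split=> //.
  by apply/setP=> x; rewrite !inE mulg1.
rewrite !big_cons; have [Sd | nSd] := eqVneq (S :* d i)%g S.
  exists w; split=> //; rewrite pre_w; apply/setP=> x; rewrite !inE.
  by rewrite (gT_comm (d i ^+ a i)%g) mulgA mem_rcoset_fix.
exists (nseq (a i) (right_translation (d i)) ++ w); split.
- move=> t; rewrite mem_cat => /orP[|/w_Cay //].
  by rewrite mem_nseq => /andP[_ /eqP->]; rewrite !imset_f.
- by rewrite size_cat size_nseq size_w.
apply/setP=> x; rewrite !inE word_act_cat; have /setP := pre_w.
set y := word_act x _ => /(_ y); rewrite !inE => ->.
suffices -> : y = (x * d i ^+ a i)%g by rewrite mulgA.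
rewrite /y; elim: (a i) {y} x => [|m IHm] x /=; first by rewrite mulg1.
by rewrite IHm ffunE expgS mulgA.
Qed.

End ShortWords.

Theorem mainTheorem6 (n k : nat) (p : 'I_k -> nat)
    (p_prime : forall i, prime (p i)) (p_inj : injective p)
    (n_fact : n = \prod_(i < k) p i)
    (gT : finGroupType) (H : 'I_k -> {group gT}) (d : 'I_k -> gT)
    (G_dprod : \big[dprod/1%g]_(i < k) (H i : {set gT}) = [set: gT])
    (H_order : forall i, #|H i| = p i)
    (d_gen : forall i, generator (H i) (d i))
    (n_k : odd n \/ 3 <= k) :
  Cerny_Cayley_graph [set d i | i : 'I_k].
Proof.
have d_order i : #[d i]%g = p i by rewrite orderE -(eqP (d_gen i)) H_order.
have prod_d g : exists2 a : 'I_k -> nat, forall i, a i <= (p i).-1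
    & g = (\prod_(i < k) d i ^+ a i)%g.
  have [b [Hb -> _]] := mem_bigdprod (G := [set: gT]%G) G_dprod (in_setT g).
  have /fin_all_exists[a Da] i : exists a, a <= (p i).-1 /\ b i = (d i ^+ a)%g.
    have := Hb i isT; rewrite (eqP (d_gen i)) => /cyclePmin[a lt_a ->].
    by exists a; rewrite -ltnS prednK ?prime_gt0 // -d_order.
  by exists a => [i|]; [case: (Da i) | apply: eq_bigr => i _; case: (Da i)].
have /cyclicP[c c_gen] : cyclic [set: gT]
  := cyclic_bigdprod_distinct_primes p_prime p_inj H_order (index_enum_uniq _) G_dprod.
have n_gt0 : 0 < #|gT| by apply/card_gt0P; exists 1%g.
have [zeta zeta_prim] := C_prim_root_exists n_gt0.
have comm := mulg_commute (esym c_gen).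
split.
  apply/eqP; rewrite eqEsubset subsetT; apply/subsetP=> g _.
  have [a _ ->] := prod_d g; apply: group_prod => i _.
  by rewrite groupX // mem_gen // imset_f.
move=> Sigma Cay_Sigma sync_Sigma.
apply: synchronizing_extension => // S S_n0 S_proper.
apply: preim_extension => // g; have [a le_a ->] := prod_d g.
(* a word for g modulo the generators fixing S; its length is bounded by e *)
have [w [w_Cay size_w pre_w]] := short_translation_word d comm S a (index_enum 'I_k).
exists w; split=> // [t /w_Cay/(subsetP Cay_Sigma) //|].
rewrite size_w; apply: leq_trans (rank_translates (esym c_gen) zeta_prim S).
have := cardsD1 1%g (spectrum c zeta S).
rewrite (spectrum1 (esym c_gen) zeta_prim S_n0) => card_R.
rewrite -(leq_add2l true) -card_R.
pose A := [set i | (S :* d i != S)%g].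
apply: leq_trans (card_order_closed p_prime p_inj (A := A) comm _ _ _ _).
- rewrite leq_add2l (eq_bigl (mem A)) => [|i]; last by rewrite !inE.
  exact: leq_sum.
- by move=> x y; apply: spectrum_order.
- exact: spectrum1.
- move=> i; rewrite inE => Sd; rewrite -d_order.
  by apply: dvdn_order_spectrum => //; rewrite d_order.
move=> i; rewrite inE => Sd p2; exists (d i).
have d2 : #[d i]%g = 2 by rewrite d_order.
have [y [Sy Syd]] := involution_spectrum (esym c_gen) zeta_prim d2 Sd.
by exists y.
Qed.
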